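(* $\textsc{Lossy-Code}\cap\textsc{Sink-Of-Metered-Line}$ reduces to $\textsc{Empty-Child-w-Height}$ by a black-box ($\le_{dt}$) reduction.
   Context: Query model with $\le_{dt}$ reductions (the target instance's input bits computed by decision trees over the source input, target solutions mapped back by decision trees, log target-input-length plus depth $\mathrm{polylog}$ in the source size). $\textsc{Lossy-Code}$: given $f:[N]\to[2N]$, $g:[2N]\to[N]$, find $x\in[2N]$ with $f(g(x))\neq x$. $\textsc{Sink-Of-Metered-Line}$: given $S,P:[M]\to[M]$ and $W:[M]\to[M]\cup\{0\}$, a solution is $1$ if $P(1)\ne1$ or $S(1)=1$ or $W(1)\ne1$; or $x$ with $P(S(x))\neq x$; or $x\ne1$ with $W(x)=1$; or $x$ with ($W(x)>0$ and $W(S(x))-W(x)\ne1$) or ($W(x)>1$ and $W(x)-W(P(x))\neq1$). $\textsc{Lossy-Code}\cap\textsc{Sink-Of-Metered-Line}$: the input is a $\textsc{Lossy-Code}$ instance together with a $\textsc{Sink-Of-Metered-Line}$ instance, and a solution is a solution to either. $\textsc{Empty-Child-w-Height}$: given $V=[K]$, $F,L,R:V\to V$, $H:V\to[K]$, a solution is (s1) $u$ with $F(L(u))\ne u$ or $F(R(u))\ne u$ or $L(u)=R(u)\ne u$; (s2) $1$ if $L(1)=1$ or $R(1)=1$ or $F(1)\ne1$; (s4) $u\ne1$ with $u\ne F(u)$ and $H(u)\ne H(F(u))+1$, or $1$ if $H(1)\ne1$. *)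

(* Defs.v *)
From mathcomp Require Import all_boot.

Set Implicit Arguments.
Unset Strict Implicit.
Unset Printing Implicit Defensive.

(** Decision trees with boolean queries in [Q] and leaf labels in [A]. *)
Inductive dtree (Q A : Type) : Type :=
| Leaf of A
| Query of Q & dtree Q A & dtree Q A.

Fixpoint dt_eval (Q A : Type) (t : dtree Q A) (x : Q -> bool) : A :=
  match t with
  | Leaf a => a
  | Query q t0 t1 => if x q then dt_eval t1 x else dt_eval t0 x
  end.

Fixpoint dt_depth (Q A : Type) (t : dtree Q A) : nat :=
  match t with
  | Leaf _ => 0
  | Query _ t0 t1 => (maxn (dt_depth t0) (dt_depth t1)).+1
  end.

(** A family of query search problems.  An instance with parameter [n] is a
    table assigning to every cell [c] a number below [alph c]; solvers only
    have access to the binary digits of the entries. *)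
Record query_problem : Type := QueryProblem {
  param : Type;
  cell : param -> finType;
  alph : forall n : param, cell n -> nat;
  out : param -> Type;
  sol : forall n : param, (forall c : cell n, 'I_(alph c)) -> out n -> Prop
}.

Arguments alph {q n} c.
Arguments sol {q n} x o.

Definition inst (A : query_problem) (n : param A) : Type :=
  forall c : cell n, 'I_(alph c).

(** Positions of the input bits: [up_log 2 a] is the ceiling of log_2 a, the
    number of bits used for a number below [a]. *)
Definition bitpos (A : query_problem) (n : param A) : finType :=
  {c : cell n & 'I_(up_log 2 (alph c))}.

Definition bits (A : query_problem) (n : param A) (x : inst n)
    (b : bitpos n) : bool :=
  odd (x (tag b) %/ 2 ^ tagged b).

Definition input_length (A : query_problem) (n : param A) : nat :=
  #|bitpos n|.

(** [A <=_dt B].  The table [y] is determined by its bits; its existence says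
    that the computed bits do encode an instance of [B] (not every bit string
    does when some [alph c] is not a power of 2).  The bound
    (ceil(log s) + 2)^c, with [c] uniform in the source parameter, expresses
    polylog(s); the shift by 2 absorbs constants and small [s]. *)
Definition dt_reducible (A B : query_problem) : Prop :=
  exists c : nat, forall n : param A,
  exists (m : param B) (d : nat)
         (T : bitpos m -> dtree (bitpos n) bool)
         (G : out m -> dtree (bitpos n) (out n)),
    [/\ forall b : bitpos m, dt_depth (T b) <= d,
        forall o : out m, dt_depth (G o) <= d,
        up_log 2 (input_length m) + d <= (up_log 2 (input_length n)).+2 ^ c
      & forall x : inst n, exists y : inst m,
          (forall b : bitpos m, bits y b = dt_eval (T b) (bits x)) /\
          (forall o : out m, sol y o -> sol x (dt_eval (G o) (bits x)))].

(** The two parameters are independent; a solution is tagged with the problem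
    it solves. *)
Definition intersection (A B : query_problem) : query_problem :=
  {| param := (param A * param B)%type;
     cell := fun n => (cell n.1 + cell n.2)%type;
     alph := fun n c => match c with inl a => alph a | inr b => alph b end;
     out := fun n => (out n.1 + out n.2)%type;
     sol := fun n x o =>
       match o with
       | inl a => sol (fun c : cell n.1 => x (inl c)) a
       | inr b => sol (fun c : cell n.2 => x (inr c)) b
       end |}.

(** Below, a parameter [n] stands for the size n + 1, so that all sizes are
    positive, and the element [i] of [1..N] is the ordinal of value i - 1; in
    particular the distinguished element 1 is [ord0]. *)

Definition lossy_code_sol (N : nat) (f : 'I_N -> 'I_(2 * N))
    (g : 'I_(2 * N) -> 'I_N) (x : 'I_(2 * N)) : Prop :=
  f (g x) <> x.

Definition lossy_code : query_problem :=
  {| param := nat;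
     cell := fun n => ('I_n.+1 + 'I_(2 * n.+1))%type;
     alph := fun n c => match c with inl _ => 2 * n.+1 | inr _ => n.+1 end;
     out := fun n => 'I_(2 * n.+1);
     sol := fun n x => lossy_code_sol (fun i => x (inl i)) (fun i => x (inr i))
  |}.

(** [W] takes values in {0, ..., M}, with no shift; the truncation of [-] is
    harmless, since a - b = 1 forces a = b + 1. *)
Definition metered_line_sol (m : nat) (S P : 'I_m.+1 -> 'I_m.+1)
    (W : 'I_m.+1 -> 'I_m.+2) (x : 'I_m.+1) : Prop :=
  [\/ x = ord0 /\ [\/ P ord0 <> ord0, S ord0 = ord0 | W ord0 <> 1 :> nat],
      P (S x) <> x,
      x <> ord0 /\ W x = 1 :> nat
    | (0 < W x /\ W (S x) - W x <> 1) \/ (1 < W x /\ W x - W (P x) <> 1)].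

Definition sink_of_metered_line : query_problem :=
  {| param := nat;
     cell := fun m => ('I_m.+1 + 'I_m.+1 + 'I_m.+1)%type;
     alph := fun m c => match c with inl _ => m.+1 | inr _ => m.+2 end;
     out := fun m => 'I_m.+1;
     sol := fun m x =>
       metered_line_sol (fun i => x (inl (inl i))) (fun i => x (inl (inr i)))
         (fun i => x (inr i)) |}.

(** [H] takes values in [1..K], hence the successor in [height]. *)
Definition empty_child_height_sol (k : nat) (F L R H : 'I_k.+1 -> 'I_k.+1)
    (u : 'I_k.+1) : Prop :=
  let height v := (H v).+1 in
  [\/ [\/ F (L u) <> u, F (R u) <> u | L u = R u /\ R u <> u],
      u = ord0 /\ [\/ L ord0 = ord0, R ord0 = ord0 | F ord0 <> ord0]
    | [/\ u <> ord0, u <> F u & height u <> height (F u) + 1]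
      \/ (u = ord0 /\ height ord0 <> 1)].

Definition empty_child_w_height : query_problem :=
  {| param := nat;
     cell := fun k => ('I_k.+1 + 'I_k.+1 + ('I_k.+1 + 'I_k.+1))%type;
     alph := fun k _ => k.+1;
     out := fun k => 'I_k.+1;
     sol := fun k x =>
       empty_child_height_sol
         (fun u => x (inl (inl u))) (fun u => x (inl (inr u)))
         (fun u => x (inr (inl u))) (fun u => x (inr (inr u))) |}.

(* Main.v *)
Require Import Defs.
From mathcomp Require Import all_boot.
From mathcomp Require Import zify.

Set Implicit Arguments.
Unset Strict Implicit.
Unset Printing Implicit Defensive.

(** A vertex of the tree is a pair (w, x) of a vertex w of the metered line and
    x in [N].  Without Lossy-Code solutions g is injective, so (w, x) can be
    given the children (S w, g (2x)) and (S w, g (2x+1)); the parent of (w, y)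
    is (P w, f y / 2) and the height is W w.  Vertices with W w = 0 become
    isolated, and all vertices (1, x) are their own parents, which the height
    problem permits.  Every defect of this tree at (w, x) comes from a
    metered-line solution at w or at 1, or from a Lossy-Code solution at 2x or
    2x+1. *)

(** * Composition of decision trees and reading of table entries *)

Fixpoint dt_bind (Q A B : Type) (t : dtree Q A) (k : A -> dtree Q B) :
    dtree Q B :=
  match t with
  | Leaf a => k a
  | Query q t0 t1 => Query q (dt_bind t0 k) (dt_bind t1 k)
  end.

Lemma dt_eval_bind (Q A B : Type) (t : dtree Q A) (k : A -> dtree Q B) x :
  dt_eval (dt_bind t k) x = dt_eval (k (dt_eval t x)) x.
Proof. by elim: t => //= q t0 IH0 t1 IH1; case: (x q). Qed.

Lemma dt_depth_bind (Q A B : Type) (t : dtree Q A) (k : A -> dtree Q B) d1 d2 :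
  dt_depth t <= d1 -> (forall a, dt_depth (k a) <= d2) ->
  dt_depth (dt_bind t k) <= d1 + d2.
Proof.
move=> t_d1 k_d2; apply: leq_trans (_ : dt_depth t + d2 <= _).
  by elim: t {t_d1} => //= q t0 IH0 t1 IH1; lia.
by rewrite leq_add2r.
Qed.

Fixpoint dt_queries (Q : Type) (qs : seq Q) : dtree Q (seq bool) :=
  if qs is q :: qs' then
    dt_bind (Query q (Leaf Q false) (Leaf Q true)) (fun b =>
    dt_bind (dt_queries qs') (fun bs => Leaf Q (b :: bs)))
  else Leaf Q [::].

Lemma dt_eval_queries (Q : Type) (qs : seq Q) x :
  dt_eval (dt_queries qs) x = map x qs.
Proof.
by elim: qs => //= q qs IH; case: (x q); rewrite dt_eval_bind IH.
Qed.

Lemma dt_depth_queries (Q : Type) (qs : seq Q) :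
  dt_depth (dt_queries qs) <= size qs.
Proof.
elim: qs => //= q qs IH; rewrite ltnS geq_max -(addn0 (size qs)).
by apply/andP; split; apply: dt_depth_bind.
Qed.

Definition nat_of_bits (bs : seq bool) : nat :=
  foldr (fun (b : bool) v => b + v.*2) 0 bs.

Lemma nat_of_bitsK k v : v < 2 ^ k ->
  nat_of_bits [seq odd (v %/ 2 ^ i) | i <- iota 0 k] = v.
Proof.
elim: k v => [|k IH] v; first by rewrite expn0; case: v.
rewrite expnS => v_lt /=; rewrite expn0 divn1.
rewrite (iotaDl 1 0 k) -map_comp (eq_map (g := fun i => odd (v./2 %/ 2 ^ i))).
  by rewrite IH ?odd_double_half //; lia.
by move=> i /=; rewrite expnS divnMA divn2.
Qed.

(** The default [v0] makes the leaf total: it is returned on bit patterns encoding no value below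
    [alph c], which never come from an instance. *)
Definition dt_read (A : query_problem) (n : param A) (c : cell n)
    (v0 : 'I_(alph c)) : dtree (bitpos n) 'I_(alph c) :=
  dt_bind (dt_queries
    [seq (Tagged (fun c : cell n => 'I_(up_log 2 (alph c))) i : bitpos n)
       | i <- enum 'I_(up_log 2 (alph c))])
    (fun bs => Leaf _ (insubd v0 (nat_of_bits bs))).

Lemma dt_eval_read (A : query_problem) (n : param A) (c : cell n)
    (v0 : 'I_(alph c)) (x : inst n) : dt_eval (dt_read v0) (bits x) = x c.
Proof.
rewrite dt_eval_bind dt_eval_queries /= -map_comp.
rewrite (map_comp (fun i => odd (x c %/ 2 ^ i)) val) val_enum_ord.
rewrite nat_of_bitsK ?valKd //.
exact: leq_trans (ltn_ord _) (up_logP _ _).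
Qed.

Lemma dt_depth_read (A : query_problem) (n : param A) (c : cell n)
    (v0 : 'I_(alph c)) : dt_depth (dt_read v0) <= up_log 2 (alph c).
Proof.
rewrite -[X in _ <= X]addn0; apply: dt_depth_bind => //.
by apply: leq_trans (dt_depth_queries _) _; rewrite size_map size_enum_ord.
Qed.

(** Trees that output whole entries encode a valid target instance by construction; a single bit is
    then obtained by relabelling leaves, at no cost in depth. *)
Lemma dt_reducible_entrywise (A B : query_problem) (e : nat) :
  (forall n : param A, exists (m : param B) (d : nat)
     (E : forall c : cell m, dtree (bitpos n) 'I_(alph c))
     (G : out m -> dtree (bitpos n) (out n)),
   [/\ forall c, dt_depth (E c) <= d,
       forall o, dt_depth (G o) <= d,
       up_log 2 (input_length m) + d <= (up_log 2 (input_length n)).+2 ^ e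
     & forall (x : inst n) o, sol (fun c => dt_eval (E c) (bits x)) o ->
         sol x (dt_eval (G o) (bits x))]) ->
  dt_reducible A B.
Proof.
move=> red; exists e => n; have [m [d [E [G [Ed Gd size_d corr]]]]] := red n.
pose T (b : bitpos m) :=
  dt_bind (E (tag b)) (fun v => Leaf _ (odd (v %/ 2 ^ tagged b))).
exists m, d, T, G; split=> // [b | x].
  by rewrite -[X in _ <= X]addn0; apply: dt_depth_bind.
exists (fun c => dt_eval (E c) (bits x)); split=> [b | o]; last exact: corr.
by rewrite dt_eval_bind.
Qed.

Lemma input_lengthE (A : query_problem) (n : param A) :
  input_length n = \sum_(c : cell n) up_log 2 (alph c).
Proof.
rewrite /input_length card_tagged sumnE big_map big_enum /=.
by apply: eq_bigr => c _; rewrite card_ord.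
Qed.

(** A decidable form of the solution predicate, on which a decision tree can branch. *)
Definition metered_line_solb (m : nat) (S P : 'I_m.+1 -> 'I_m.+1)
    (W : 'I_m.+1 -> 'I_m.+2) (x : 'I_m.+1) : bool :=
  [|| (x == ord0) &&
        [|| P ord0 != ord0, S ord0 == ord0 | W ord0 != 1 :> nat],
      P (S x) != x,
      (x != ord0) && (W x == 1 :> nat),
      (0 < W x) && (W (S x) - W x != 1)
    | (1 < W x) && (W x - W (P x) != 1)].

Lemma metered_line_solP (m : nat) (S P : 'I_m.+1 -> 'I_m.+1)
    (W : 'I_m.+1 -> 'I_m.+2) (x : 'I_m.+1) :
  reflect (metered_line_sol S P W x) (metered_line_solb S P W x).
Proof.
apply: (iffP idP).
  case/or4P=> [/andP[/eqP x0 /or3P root] | /eqP | /andP[/eqP ? /eqP] | ].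
  - apply: Or41; split=> //.
    by case: root => /eqP; [apply: Or31 | apply: Or32 | apply: Or33].
  - exact: Or42.
  - by move=> ?; apply: Or43.
  by case/orP=> /andP[? /eqP ?]; apply: Or44; [left|right].
rewrite /metered_line_solb; case=> [[-> root] | /eqP-> | [/eqP-> /eqP->] | ].
- by rewrite eqxx; case: root => /eqP->; rewrite ?orbT.
- by rewrite !orbT.
- by rewrite !orbT.
by case=> -[-> /eqP->]; rewrite !orbT.
Qed.

(** * The tree on pairs and its freedom from defects *)

Section TreeVertices.

Context {n m : nat}.

(** The target parameter k stands for size k + 1, hence the predecessor of the product under a
    successor. *)
Let vertex := 'I_(m.+1 * n.+1).-1.+1.

Definition line_part (u : vertex) : 'I_m.+1 := inord (u %/ n.+1).
Definition code_part (u : vertex) : 'I_n.+1 := inord (u %% n.+1).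
Definition mk_vertex (w : 'I_m.+1) (x : 'I_n.+1) : vertex :=
  inord (w * n.+1 + x).

Lemma val_mk_vertex w x : mk_vertex w x = w * n.+1 + x :> nat.
Proof.
rewrite inordK // prednK ?muln_gt0 //.
apply: leq_trans (leq_mul (ltn_ord w) (leqnn _)).
by rewrite mulSn addnC ltn_add2r.
Qed.

Lemma line_part_mk w x : line_part (mk_vertex w x) = w.
Proof.
by rewrite /line_part val_mk_vertex divnMDl // divn_small // addn0 inord_val.
Qed.

Lemma code_part_mk w x : code_part (mk_vertex w x) = x.
Proof. by rewrite /code_part val_mk_vertex modnMDl modn_small // inord_val. Qed.

Lemma mk_vertexK u : mk_vertex (line_part u) (code_part u) = u.
Proof.
apply: val_inj; rewrite /= val_mk_vertex !inordK ?ltn_pmod -?divn_eq //.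
by rewrite ltn_divLR // -[(m.+1 * _)%N]prednK ?muln_gt0.
Qed.

Lemma line_part0 : line_part ord0 = ord0.
Proof. by apply: val_inj; rewrite /= inordK div0n. Qed.

Lemma dbl_subproof (b : bool) (x : 'I_n.+1) : b + x.*2 < 2 * n.+1.
Proof. by have := ltn_ord x; lia. Qed.

Definition dbl b x : 'I_(2 * n.+1) := Ordinal (dbl_subproof b x).
Definition hlf (y : 'I_(2 * n.+1)) : 'I_n.+1 := inord y./2.

Lemma dblK b : cancel (dbl b) hlf.
Proof. by move=> x; rewrite /hlf /= half_bit_double inord_val. Qed.

(** The arguments [Ww], [Sw], [Pw], [gx] and [fy] are the source entries that
    the entry of the tree at [u] depends on. *)

Definition tree_child (u : vertex) (Ww : 'I_m.+2) (Sw : 'I_m.+1)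
    (gx : 'I_n.+1) : vertex :=
  if Ww == 0 :> nat then u else mk_vertex Sw gx.

Definition tree_parent (u : vertex) (Ww : 'I_m.+2) (Pw : 'I_m.+1)
    (fy : 'I_(2 * n.+1)) : vertex :=
  if (Ww == 0 :> nat) || (line_part u == ord0) then u
  else mk_vertex Pw (hlf fy).

(** Stored heights are shifted by one while [W] is not. Truncation at [W] = 0 is harmless, since
    such a vertex is its own parent. *)
Definition tree_height (Ww : 'I_m.+2) : vertex := inord Ww.-1.

Lemma val_tree_height Ww : tree_height Ww = Ww.-1 :> nat.
Proof.
rewrite inordK // [X in _ < X]prednK ?muln_gt0 //.
by apply: leq_trans (leq_pmulr m.+1 (ltn0Sn n)); have := ltn_ord Ww; lia.
Qed.

(** The contrapositive of correctness, in local form: only the line vertices w and 1 and the two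
    doubles of x are assumed good, which is all that a shallow tree can test. *)
Lemma tree_no_solution (f : 'I_n.+1 -> 'I_(2 * n.+1))
    (g : 'I_(2 * n.+1) -> 'I_n.+1) (S P : 'I_m.+1 -> 'I_m.+1)
    (W : 'I_m.+1 -> 'I_m.+2) (u : vertex) :
  let w := line_part u in let x := code_part u in
  ~~ metered_line_solb S P W w -> ~~ metered_line_solb S P W ord0 ->
  (forall b, f (g (dbl b x)) = dbl b x) ->
  let child b v :=
    tree_child v (W (line_part v)) (S (line_part v)) (g (dbl b (code_part v))) in
  ~ empty_child_height_sol
      (fun v => tree_parent v (W (line_part v)) (P (line_part v)) (f (code_part v)))
      (child false) (child true) (fun v => tree_height (W (line_part v))) u.
Proof.
move=> w x nsol_w nsol_0 fgK child.
have{nsol_0} [P0 S0 W0] : [/\ P ord0 = ord0, S ord0 != ord0 & W ord0 = 1 :> nat].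
  move: nsol_0; rewrite /metered_line_solb eqxx /= !negb_or !negbK.
  by case/and4P=> /and3P[/eqP-> -> /eqP->].
move: nsol_w; rewrite /metered_line_solb !negb_or !negb_and !negbK -!leqNgt.
case/and5P=> _ /eqP PS W1 WS WP.
have parent_child b :
  (fun v => tree_parent v (W (line_part v)) (P (line_part v)) (f (code_part v)))
    (child b u) = u.
  rewrite /child /tree_child -/w; have [Ww0|Ww_neq0] := eqVneq (W w : nat) 0.
    by rewrite /tree_parent -/w Ww0.
  rewrite /tree_parent line_part_mk code_part_mk fgK dblK PS.
  (* Otherwise w = P (S w) = P 1 = 1, whence S 1 = 1. So the child avoids the self-loop clause of
     [tree_parent]. *)
  have Sw_neq0 : S w != ord0.
    apply: contraNneq S0 => Sw0; have w0 : w = ord0 by rewrite -PS Sw0.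
    by rewrite -{1}w0 Sw0.
  rewrite (negPf Sw_neq0) orbF; case: eqP => [WSw0|_]; last exact: mk_vertexK.
  by move: WS; rewrite WSw0 leqn0 (negPf Ww_neq0).
have child_root b : child b ord0 != ord0.
  apply: contraNneq S0; rewrite /child /tree_child line_part0 W0 /=.
  by move/(congr1 line_part); rewrite line_part_mk line_part0 => ->.
case=> [[ | | [LR Ru]] | [u0] | [[_] | [u0]]].
- by rewrite parent_child.
- by rewrite parent_child.
- move: LR Ru; rewrite /child /tree_child -/w -/x; case: ifP => // _.
  (* Applying [f] to equal code parts would identify 2x with 2x+1. *)
  move/(congr1 code_part); rewrite !code_part_mk => /(congr1 f).
  by rewrite !fgK => /(congr1 val) /=; lia.
- case=> [/eqP | /eqP | ]; rewrite ?(negPf (child_root _)) //.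
  by rewrite /tree_parent line_part0 eqxx orbT.
- rewrite /tree_parent -/w; case: ifP => // /norP[Ww_neq0 w_neq0] _.
  rewrite line_part_mk !val_tree_height.
  (* Away from 1, a positive weight exceeds 1, so the predecessor clause gives a drop of exactly
     one. *)
  rewrite (negPf w_neq0) /= in W1.
  by move: WP W1 Ww_neq0; lia.
by rewrite line_part0 val_tree_height W0.
Qed.

End TreeVertices.

Lemma eq_empty_child_height_sol (k : nat)
    (F L R H F' L' R' H' : 'I_k.+1 -> 'I_k.+1) (u : 'I_k.+1) :
  F =1 F' -> L =1 L' -> R =1 R' -> H =1 H' ->
  empty_child_height_sol F L R H u -> empty_child_height_sol F' L' R' H' u.
Proof.
move=> eqF eqL eqR eqH.
by rewrite /empty_child_height_sol !eqF !eqL !eqR !eqH.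
Qed.

Lemma input_length_tree k :
  @input_length empty_child_w_height k = 4 * k.+1 * up_log 2 k.+1.
Proof.
rewrite input_lengthE /= sum_nat_const !card_sum !card_ord.
by rewrite !addnn -!mul2n mulnA.
Qed.

(** * Decision trees for the target entries and for mapping solutions back *)

Section Reduction.

Context {n m : nat}.

Let source := intersection lossy_code sink_of_metered_line.
Let nm : param source := (n, m).
Let Q := bitpos nm.
Let vertex := 'I_(m.+1 * n.+1).-1.+1.

Definition read_f (i : 'I_n.+1) : dtree Q 'I_(2 * n.+1) :=
  @dt_read source nm (inl (inl i)) (dbl false ord0).
Definition read_g (i : 'I_(2 * n.+1)) : dtree Q 'I_n.+1 :=
  @dt_read source nm (inl (inr i)) ord0.
Definition read_S (i : 'I_m.+1) : dtree Q 'I_m.+1 :=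
  @dt_read source nm (inr (inl (inl i))) ord0.
Definition read_P (i : 'I_m.+1) : dtree Q 'I_m.+1 :=
  @dt_read source nm (inr (inl (inr i))) ord0.
Definition read_W (i : 'I_m.+1) : dtree Q 'I_m.+2 :=
  @dt_read source nm (inr (inr i)) ord0.

Definition child_dt (b : bool) (u : vertex) : dtree Q vertex :=
  dt_bind (read_W (line_part u)) (fun Ww =>
  dt_bind (read_S (line_part u)) (fun Sw =>
  dt_bind (read_g (dbl b (code_part u))) (fun gx =>
  Leaf Q (tree_child u Ww Sw gx)))).

Definition parent_dt (u : vertex) : dtree Q vertex :=
  dt_bind (read_W (line_part u)) (fun Ww =>
  dt_bind (read_P (line_part u)) (fun Pw =>
  dt_bind (read_f (code_part u)) (fun fy =>
  Leaf Q (tree_parent u Ww Pw fy)))).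

Definition height_dt (u : vertex) : dtree Q vertex :=
  dt_bind (read_W (line_part u)) (fun Ww => Leaf Q (tree_height Ww)).

Definition entry_dt (c : vertex + vertex + (vertex + vertex)) : dtree Q vertex :=
  match c with
  | inl (inl u) => parent_dt u
  | inl (inr u) => child_dt false u
  | inr (inl u) => child_dt true u
  | inr (inr u) => height_dt u
  end.

(** The queries are adaptive: [P] and [W] are read at the value of S w, and [W] at that of P w. *)
Definition metered_line_dt (w : 'I_m.+1) : dtree Q bool :=
  dt_bind (read_P ord0) (fun P0 =>
  dt_bind (read_S ord0) (fun S0 =>
  dt_bind (read_W ord0) (fun W0 =>
  dt_bind (read_S w) (fun Sw =>
  dt_bind (read_P Sw) (fun PSw =>
  dt_bind (read_W w) (fun Ww =>
  dt_bind (read_W Sw) (fun WSw =>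
  dt_bind (read_P w) (fun Pw =>
  dt_bind (read_W Pw) (fun WPw =>
  Leaf Q [|| (w == ord0) && [|| P0 != ord0, S0 == ord0 | W0 != 1 :> nat],
             PSw != w,
             (w != ord0) && (Ww == 1 :> nat),
             (0 < Ww) && (WSw - Ww != 1)
           | (1 < Ww) && (Ww - WPw != 1)]))))))))).

(** The last candidate 2x+1 is returned untested: if [u] is a defect and the earlier tests fail, it
    must be a solution. *)
Definition solution_dt (u : vertex) : dtree Q ('I_(2 * n.+1) + 'I_m.+1) :=
  let w := line_part u in
  let x0 := dbl false (code_part u) in
  dt_bind (metered_line_dt w) (fun b => if b then Leaf Q (inr w) else
  dt_bind (metered_line_dt ord0) (fun b => if b then Leaf Q (inr ord0) else
  dt_bind (read_g x0) (fun y => dt_bind (read_f y) (fun z =>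
  Leaf Q (inl (if z != x0 then x0 else dbl true (code_part u))))))).

(** * Query depth, counted in entry reads of at most [D] bits each *)

Section Depth.

Context (D : nat).
Hypothesis cell_bound : forall c : cell nm, up_log 2 (alph c) <= D.

Let read_bound (c : cell nm) v0 : dt_depth (@dt_read source nm c v0) <= D.
Proof. exact: leq_trans (dt_depth_read _) (cell_bound c). Qed.

Let read_f_bound i : dt_depth (read_f i) <= D. Proof. exact: read_bound. Qed.
Let read_g_bound i : dt_depth (read_g i) <= D. Proof. exact: read_bound. Qed.
Let read_S_bound i : dt_depth (read_S i) <= D. Proof. exact: read_bound. Qed.
Let read_P_bound i : dt_depth (read_P i) <= D. Proof. exact: read_bound. Qed.
Let read_W_bound i : dt_depth (read_W i) <= D. Proof. exact: read_bound. Qed.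

#[local] Hint Resolve read_f_bound read_g_bound read_S_bound read_P_bound
  read_W_bound : core.

Let bind_bound (A B : Type) (t : dtree Q A) (k : A -> dtree Q B) e :
  dt_depth t <= D -> (forall v, dt_depth (k v) <= e * D) ->
  dt_depth (dt_bind t k) <= e.+1 * D.
Proof. by move=> t_D k_e; rewrite mulSn; apply: dt_depth_bind. Qed.

Lemma dt_depth_entry c : dt_depth (entry_dt c) <= 3 * D.
Proof.
case: c => [[u|u]|[u|u]].
- by do 3![apply: bind_bound => // ?].
- by do 3![apply: bind_bound => // ?].
- by do 3![apply: bind_bound => // ?].
- by apply: bind_bound => // ?.
Qed.

Lemma dt_depth_metered_line w : dt_depth (metered_line_dt w) <= 9 * D.
Proof. by do 9![apply: bind_bound => // ?]. Qed.

Lemma dt_depth_solution u : dt_depth (solution_dt u) <= 20 * D.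
Proof.
(* Two line tests of nine reads each, then one read of [g] and one of [f]. *)
rewrite (mulnDl 9 11); apply: dt_depth_bind (dt_depth_metered_line _) _ => -[] //.
rewrite (mulnDl 9 2); apply: dt_depth_bind (dt_depth_metered_line _) _ => -[] //.
by do 2![apply: bind_bound => // ?].
Qed.

End Depth.

(** * Correctness of the solution map, then size bounds *)

Let eval_f (x : inst nm) i : dt_eval (read_f i) (bits x) = x (inl (inl i)).
Proof. exact: (@dt_eval_read source nm (inl (inl i)) (dbl false ord0)). Qed.
Let eval_g (x : inst nm) i : dt_eval (read_g i) (bits x) = x (inl (inr i)).
Proof. exact: (@dt_eval_read source nm (inl (inr i)) ord0). Qed.
Let eval_S (x : inst nm) i :
  dt_eval (read_S i) (bits x) = x (inr (inl (inl i))).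
Proof. exact: (@dt_eval_read source nm (inr (inl (inl i))) ord0). Qed.
Let eval_P (x : inst nm) i :
  dt_eval (read_P i) (bits x) = x (inr (inl (inr i))).
Proof. exact: (@dt_eval_read source nm (inr (inl (inr i))) ord0). Qed.
Let eval_W (x : inst nm) i : dt_eval (read_W i) (bits x) = x (inr (inr i)).
Proof. exact: (@dt_eval_read source nm (inr (inr i)) ord0). Qed.

Let dt_evalE := (eval_f, eval_g, eval_S, eval_P, eval_W).

Lemma dt_eval_metered_line (x : inst nm) w :
  dt_eval (metered_line_dt w) (bits x) =
  metered_line_solb (fun i => x (inr (inl (inl i))))
    (fun i => x (inr (inl (inr i)))) (fun i => x (inr (inr i))) w.
Proof. by rewrite !(dt_evalE, dt_eval_bind). Qed.

Lemma solution_dt_correct (x : inst nm) (u : vertex) :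
  @sol empty_child_w_height (m.+1 * n.+1).-1
    (fun c => dt_eval (entry_dt c) (bits x)) u ->
  sol x (dt_eval (solution_dt u) (bits x)).
Proof.
move=> sol_u; rewrite /solution_dt dt_eval_bind dt_eval_metered_line.
case: ifPn => [|nsol_w]; first by move/metered_line_solP.
rewrite dt_eval_bind dt_eval_metered_line.
case: ifPn => [|nsol_0]; first by move/metered_line_solP.
rewrite !(dt_evalE, dt_eval_bind) /=.
(* In the second case the goal is itself an inequality at 2x+1, so introducing its negation gives f
   (g y) = y at both doubles. *)
case: ifPn => [/eqP //|/negPn/eqP fg0 fg1].
apply: (tree_no_solution nsol_w nsol_0 (f := fun i => x (inl (inl i)))
  (g := fun i => x (inl (inr i)))) => [[] //|].
by apply: eq_empty_child_height_sol sol_u => v;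
  rewrite /= /parent_dt /child_dt /height_dt !(dt_evalE, dt_eval_bind).
Qed.

(** The tables of [f] and [W] suffice: their alphabets have at least two letters, so each cell takes
    at least one bit. The other alphabets may have size 1. *)
Lemma input_length_ge : n.+1 + m.+1 <= input_length nm.
Proof.
rewrite input_lengthE !big_sumType /= !sum_nat_const !card_ord.
have log1 : 0 < up_log 2 (2 * n.+1) by rewrite up_log_gt0 /=; lia.
have log2 : 0 < up_log 2 m.+2 by rewrite up_log_gt0.
by move: log1 log2; set a := up_log 2 (2 * _); set b := up_log 2 m.+2; nia.
Qed.

Lemma cell_log_bound (c : cell nm) :
  up_log 2 (alph c) <= (up_log 2 (input_length nm)).+1.
Proof.
apply: up_log_min => //; rewrite expnS.
apply: leq_trans (_ : 2 * input_length nm <= _); last first.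
  by rewrite leq_mul2l up_logP.
move: input_length_ge; set s := input_length nm => ge_s.
by case: c => [[c|c]|[c|c]] /=; lia.
Qed.

(** With s the source length and K the number of vertices, K <= s^2. The crude bound log K <= K is
    enough, as only the logarithm of 4 K log K matters. *)
Lemma target_log_bound :
  up_log 2 (@input_length empty_child_w_height (m.+1 * n.+1).-1)
    <= 2 + 4 * up_log 2 (input_length nm).
Proof.
rewrite input_length_tree prednK ?muln_gt0 //; set K := m.+1 * n.+1.
have logK : up_log 2 K <= K by rewrite up_log_min // ltnW // ltn_expl.
have := input_length_ge; have := up_logP (input_length nm) (ltnSn 1).
set l := up_log 2 (input_length nm); set s := input_length nm => le_s ge_s.
have K_le : K <= (2 ^ l) ^ 2.
  rewrite -mulnn; apply: leq_mul; apply: leq_trans le_s; apply: leq_trans ge_s.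
    exact: leq_addl.
  exact: leq_addr.
apply: up_log_min => //; rewrite expnD -mulnA leq_mul2l /=.
apply: leq_trans (leq_mul K_le (leq_trans logK K_le)) _.
by rewrite -expnD -expnM mulnC.
Qed.

End Reduction.

Theorem theorem5p6 :
  dt_reducible (intersection lossy_code sink_of_metered_line)
    empty_child_w_height.
Proof.
apply: (@dt_reducible_entrywise _ _ 6) => -[n m].
pose D := (up_log 2 (@input_length
  (intersection lossy_code sink_of_metered_line) (n, m))).+1.
exists (m.+1 * n.+1).-1, (20 * D), (@entry_dt n m), (@solution_dt n m).
split=> [c | u | | x u].
- apply: leq_trans (dt_depth_entry (@cell_log_bound n m) c) _.
  by rewrite leq_mul2r orbT.
- exact: dt_depth_solution (@cell_log_bound n m) u.
- apply: leq_trans (leq_add (@target_log_bound n m) (leqnn _)) _.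
  (* The exponent 6: 2 + 4l + 20(l+1) <= 32(l+2), and 32 = 2^5 <= (l+2)^5. *)
  rewrite /D; set l := up_log 2 _; rewrite expnS.
  apply: leq_trans (leq_mul (leqnn l.+2) (_ : 2 ^ 5 <= _)); first lia.
  by rewrite leq_exp2r.
exact: solution_dt_correct.
Qed.
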